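(* Let $L$ be a finite supersolvable lattice. Every $M$-chain EL-labeling of $L$ (in the sense of Stanley) is polygon strong. Thus, these EL-labelings are polygon complete.
   Context: A finite lattice $L$ is supersolvable if it has a maximal chain $M:\hat 0=w_0\lessdot w_1\lessdot\dots\lessdot w_n=\hat 1$ (an $M$-chain) such that for every chain $K$ of $L$ the sublattice generated by $K$ and $M$ is distributive. The $M$-chain EL-labeling is $\lambda(x,y)=\min\{i: x\vee w_i=y\vee w_i\}$ for $x\lessdot y$. For a finite poset $P$ with least element $\hat 0$ and greatest element $\hat 1$, $\mathcal M(P)$ is the set of maximal chains. For a chain $c$ and $x\in c$ write $c^x=\{w\in c: w\le x\}$, $c_x=\{w\in c: w\ge x\}$. An edge labeling $\lambda$ assigns to each cover relation a label in a poset $\Lambda$; a saturated chain gets the sequence of labels of its edges from bottom to top. A sequence is ascending if weakly increasing. $\lambda$ is an EL-labeling if for every $x<y$ the interval $[x,y]$ has a unique ascending maximal chain and it lexicographically precedes all other maximal chains of $[x,y]$. A saturated chain $u\lessdot v\lessdot w$ is a descent if $\lambda(u,v)\not\le\lambda(v,w)$. An EL-labeling is polygon strong if for each descent $x\lessdot y\lessdot z$ one has $\lambda(y,z)<\lambda(y',z)$, where $y'$ is the coatom of $[x,z]$ contained in the unique ascending maximal chain of $[x,z]$. Polygon move: $m\to m'$ if there are $x<z$ in $m\cap m'$ with $m^x=m'^x$, $m_z=m'_z$, such that $m'\cap[x,z]$ is a descent $x\lessdot y\lessdot z$ with $y\notin m$, while $m\cap[x,z]$ is the unique ascending maximal chain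 of $[x,z]$. The maximal chain descent order $P_\lambda(2)$ is $\mathcal M(P)$ partially ordered by the reflexive and transitive closure of $\to$. $\lambda$ is polygon complete if $m\to m'$ always implies that $m'$ covers $m$ in $P_\lambda(2)$. *)

(* Defs.v *)
From mathcomp Require Import all_boot all_order.

Set Implicit Arguments.
Unset Strict Implicit.
Unset Printing Implicit Defensive.

Import Order.TTheory.

Local Open Scope order_scope.

Section Chains.

Context {d : Order.disp_t} {P : finPOrderType d}.
Implicit Types (x y z : P) (c : {set P}).

Definition covers x y : bool := (x < y) && [forall z, ~~ (x < z < y)].

Definition interval x y : {set P} := [set z | x <= z <= y].

Definition is_chain c : bool := [forall x in c, forall y in c, x >=< y].

(* The maximal chains of the subposet [A]; those of [P] are obtained for
   [A := setT] and those of [[x, y]] for [A := interval x y]. *)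
Definition max_chain (A c : {set P}) : bool :=
  maxset (fun c' : {set P} => is_chain c' && (c' \subset A)) c.

End Chains.

Section EdgeLabelings.

Context {d d' : Order.disp_t} {P : finPOrderType d} {Lam : porderType d'}.

(* An edge labeling is a total function on pairs; only its values on pairs
   [x, y] with [covers x y] are ever used. *)
Implicit Types (lam : P -> P -> Lam) (x y z : P) (c m : {set P}).

Definition label_seq lam c : seq Lam :=
  if sort <=%O (enum c) is x :: s then pairmap lam x s else [::].

Definition ascending lam c : bool := sorted <=%O (label_seq lam c).

Definition unique_ascending lam x y c : bool :=
  [&& max_chain (interval x y) c, ascending lam c &
      [forall c' : {set P},
         max_chain (interval x y) c' && ascending lam c' ==> (c' == c)]].

Definition EL_labeling lam : Prop :=
  forall x y, x < y ->
    exists2 c, unique_ascending lam x y c &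
      forall c', max_chain (interval x y) c' -> c' != c ->
        (label_seq lam c < label_seq lam c' :> seqlexi Lam).

Definition descent lam x y z : bool :=
  [&& covers x y, covers y z & ~~ (lam x y <= lam y z)].

Definition polygon_strong lam : Prop :=
  EL_labeling lam /\
  forall x y z, descent lam x y z ->
    forall c y', unique_ascending lam x z c -> y' \in c -> covers y' z ->
      lam y z < lam y' z.

Definition polygon_move lam m m' : bool :=
  [&& max_chain setT m, max_chain setT m' &
      [exists x, exists y, exists z,
        [&& x < z, (x \in m :&: m') && (z \in m :&: m'),
            [set u in m | u <= x] == [set u in m' | u <= x],
            [set u in m | z <= u] == [set u in m' | z <= u],
            (m' :&: interval x z == [set x; y; z]) && descent lam x y z,
            y \notin m &
            unique_ascending lam x z (m :&: interval x z)]]].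

(* The order relation of P_lam(2) on the maximal chains of [P]; [connect] is
   the reflexive and transitive closure. *)
Definition chain_descent_le lam m m' : bool := connect (polygon_move lam) m m'.

Definition chain_descent_lt lam m m' : bool :=
  (m != m') && chain_descent_le lam m m'.

Definition chain_descent_covers lam m m' : Prop :=
  chain_descent_lt lam m m' /\
  forall m'', max_chain setT m'' ->
    ~ (chain_descent_lt lam m m'' /\ chain_descent_lt lam m'' m').

Definition polygon_complete lam : Prop :=
  forall m m', polygon_move lam m m' -> chain_descent_covers lam m m'.

End EdgeLabelings.

Section Supersolvable.

Context {d : Order.disp_t} {L : finTBLatticeType d}.

Definition is_sublattice (S : {set L}) : bool :=
  [forall x in S, forall y in S, (x `&` y \in S) && (x `|` y \in S)].

Definition generated_sublattice (A : {set L}) : {set L} :=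
  \bigcap_(S : {set L} | is_sublattice S && (A \subset S)) S.

Definition distributive_on (S : {set L}) : Prop :=
  {in S & &, forall x y z, x `&` (y `|` z) = (x `&` y) `|` (x `&` z)}.

Definition M_chain (n : nat) (w : 'I_n.+1 -> L) : Prop :=
  [/\ w ord0 = \bot,
      w ord_max = \top,
      forall i : 'I_n, covers (w (widen_ord (leqnSn n) i)) (w (lift ord0 i)) &
      forall K : {set L}, is_chain K ->
        distributive_on (generated_sublattice (K :|: [set w i | i : 'I_n.+1]))].

(* For an M-chain the minimum is over a nonempty set: [ord_max] qualifies since
   [w ord_max = \top]. *)
Definition M_chain_labeling (n : nat) (w : 'I_n.+1 -> L) (x y : L) : nat :=
  [arg min_(i < ord_max | x `|` w i == y `|` w i) (i : nat)]%N.

End Supersolvable.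

Definition supersolvable {d : Order.disp_t} (L : finTBLatticeType d) : Prop :=
  exists (n : nat) (w : 'I_n.+1 -> L), M_chain w.

(* Main.v *)
Require Import Defs.
From mathcomp Require Import all_boot all_order.

(** Write [x <. y] when [y] covers [x]; its label is then the least [i] with
    [y <= x \/ w_i] ([M_label_le]).  Supersolvability enters through the
    modularity of the [w_i]: [(x \/ w_i) /\ y = x \/ (w_i /\ y)] for [x <= y]
    ([M_chain_modular]).

    Fix [x < y] and let [i] be least with [(x \/ w_i) /\ y != x].  Modularity
    gives that [x1 := (x \/ w_i) /\ y] covers [x]; this greedy atom of
    [[x, y]] has label at most [i], every other atom has label greater than
    [i] ([M_chain_atom]), and since [w_i /\ y <= x1] every cover above [x1]
    in [[x, y]] has label greater than [i] ([M_label_gt]).  Moreover a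
    saturated chain from [x] up to some element above [x1] has to swallow
    [x1] at some step, and that step has label at most [i], because it is
    obtained by joining with something below [x \/ w_i]
    ([M_path_small_label]).  So an ascending chain of [[x, y]] starts with
    [x1], the greedy chain is ascending and lexicographically first, and the
    labeling is an EL-labeling.  The same three facts give the polygon strong
    property: in a descent [x <. y <. z] the element [y] is not the greedy
    atom [x1] of [[x, z]], so the step [y <. z] swallows [x1] and has label at
    most [i], whereas the coatom of the ascending chain lies above [x1], so its
    step to [z] has label greater than [i].

    Polygon strong labelings are polygon complete for the following reason,
    valid for every finite poset.  A move replaces the part of a maximal chain
    in [[x, z]] by a descent.  It raises the label of the lowest step that it
    changes (by the EL property, [ascending_first_label_lt]) and lowers the
    label of the highest step that it changes (by polygon strength,
    [move_coatom]).  Hence sequences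
    of moves are strictly monotone for two lexicographic comparisons, one read
    from the bottom and one from the top ([diverges] and [codiverges]).  Now
    let a move lead from [m] to [m'] at [x <. y <. z], and consider any
    sequence of moves from [m] to [m'], with last move from [k] to [m'] at
    [u <. t <. v].  If [u < x], then [k] precedes [m] for the first comparison,
    and if [u > x], then [k] precedes [m] for the second one; both are absurd,
    as moves lead from [m] to [k].  So [u = x], whence [t = y] and [v = z], and [k = m] because
    the ascending chain of [[x, z]] is unique.  No chain can then lie strictly
    between [m] and [m']. *)

Set Implicit Arguments.
Unset Strict Implicit.
Unset Printing Implicit Defensive.

Import Order.TTheory.

(** * Maximal chains of intervals as lists of successive covers *)

Section MaximalChains.

Context {d : Order.disp_t} {P : finPOrderType d}.
Implicit Types (x y z : P) (c : {set P}) (s : seq P).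

Local Open Scope order_scope.

Lemma coversP x y :
  reflect (x < y /\ forall z, x <= z -> z <= y -> z = x \/ z = y) (covers x y).
Proof.
apply: (iffP andP) => -[lt_xy nz]; split=> //.
  move=> z le_xz le_zy; move/forallP: nz => /(_ z).
  case: (eqVneq x z) => [<-|neq_xz]; first by left.
  case: (eqVneq z y) => [<-|neq_zy]; first by right.
  by rewrite !lt_neqAle le_xz le_zy neq_xz neq_zy.
apply/forallP => z; apply/negP => /andP[lt_xz lt_zy].
by case: (nz z (ltW lt_xz) (ltW lt_zy)) (lt_xz) (lt_zy) => ->; rewrite ltxx.
Qed.

Lemma covers_lt x y : covers x y -> x < y.
Proof. by case/andP. Qed.

Lemma covers_le x y : covers x y -> x <= y.
Proof. by move/covers_lt/ltW. Qed.

Lemma covers_squeeze x y z :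
  covers x y -> x <= z -> z <= y -> z = x \/ z = y.
Proof. by case/coversP => _; apply. Qed.

Lemma covers_comparable_le x y z :
  covers x y -> x < z -> y >=< z -> y <= z.
Proof.
move=> cxy lt_xz /orP[//|le_zy].
by case: (covers_squeeze cxy (ltW lt_xz) le_zy) (lt_xz) => ->; rewrite ?ltxx.
Qed.

Lemma is_chainP c : reflect {in c &, forall x y, x >=< y} (is_chain c).
Proof.
apply: (iffP forall_inP) => [h x y cx cy|h x cx].
  exact: (forall_inP (h x cx)).
by apply/forall_inP => y; apply: h.
Qed.

Lemma max_chainP (A c : {set P}) :
  reflect [/\ {in c &, forall x y, x >=< y}, {subset c <= A} &
           forall z, z \in A -> {in c, forall x, z >=< x} -> z \in c]
          (max_chain A c).
Proof.
apply: (iffP maxsetP).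
  case=> /andP[/is_chainP chc /subsetP scA] maxc; split=> // z Az cmp_z.
  rewrite -(maxc (z |: c)) ?setU11 ?subsetUr //.
  apply/andP; split; last first.
    by apply/subsetP => u; rewrite !inE => /orP[/eqP->|/scA].
  apply/is_chainP => u v; rewrite !inE.
  case/orP => [/eqP->|cu]; case/orP => [/eqP->|cv].
  - exact: comparablexx.
  - exact: cmp_z.
  - by rewrite comparable_sym; apply: cmp_z.
  - exact: chc.
case=> chc scA maxc; split=> [|c' /andP[/is_chainP chc' /subsetP sc'A] scc'].
  by apply/andP; split; [apply/is_chainP | apply/subsetP].
apply/eqP; rewrite eqEsubset scc' andbT; apply/subsetP => z c'z.
by apply: maxc (sc'A _ c'z) _ => x cx; apply: chc' => //; apply: (subsetP scc').
Qed.

Lemma covers_path_lt x s : path covers x s -> path <%O x s.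
Proof. by apply: sub_path => u v /covers_lt. Qed.

Lemma covers_path_min x s z : path covers x s -> z \in s -> x < z.
Proof.
by move/covers_path_lt/(order_path_min lt_trans)/allP => min_s /min_s.
Qed.

Lemma covers_path_ge x s z : path covers x s -> z \in x :: s -> x <= z.
Proof.
by move=> cs; rewrite inE => /orP[/eqP->|/(covers_path_min cs)/ltW].
Qed.

Lemma covers_path_le_last x s z :
  path covers x s -> z \in x :: s -> z <= last x s.
Proof.
elim: s x => [|b s IHs] x /=; first by rewrite inE => _ /eqP->.
case/andP => cxb cs; rewrite inE => /orP[/eqP->|]; last exact: (IHs b cs).
by apply: le_trans (covers_le cxb) _; apply: covers_path_ge cs (mem_last b s).
Qed.

(** Walking up the list, an element comparable with every entry is caught
    between two consecutive entries, hence equals one of them. *)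
Lemma covers_path_maximal x s z :
    path covers x s -> x <= z -> z <= last x s ->
  {in x :: s, forall u, z >=< u} -> z \in x :: s.
Proof.
elim: s x => [|b s IHs] x /=.
  by move=> _ le_xz le_zx _; rewrite inE eq_le le_xz le_zx.
case/andP => cxb cs le_xz le_zl cmp_z.
have /orP[le_zb|le_bz]: z >=< b by apply: cmp_z; rewrite !inE eqxx orbT.
  by case: (covers_squeeze cxb le_xz le_zb) => ->; rewrite !inE eqxx ?orbT.
rewrite inE IHs ?orbT // => u us; apply: cmp_z.
by rewrite inE us orbT.
Qed.

Lemma covers_path_chain x s :
  path covers x s -> {in x :: s &, forall u v, u >=< v}.
Proof.
elim: s x => [|b s IHs] x /=.
  by move=> _ u v; rewrite !inE => /eqP-> /eqP->; rewrite comparablexx.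
case/andP => cxb cs u v; rewrite inE => /orP[/eqP->|us]; last first.
  rewrite inE => /orP[/eqP->|vs]; last exact: (IHs b cs).
  rewrite comparable_sym; apply: le_comparable.
  by apply: le_trans (covers_le cxb) (covers_path_ge cs us).
move=> vs; apply: le_comparable.
by apply: (covers_path_ge (s := b :: s)) vs; rewrite /= cxb.
Qed.

Lemma sort_covers_path x s :
  path covers x s -> sort <=%O (enum [set z in x :: s]) = x :: s.
Proof.
move=> cs; have lt_s := covers_path_lt cs.
have uniq_s: uniq (x :: s) by apply: lt_sorted_uniq.
have perm_s: perm_eq (sort <=%O (enum [set z in x :: s])) (x :: s).
  rewrite perm_sort; apply: uniq_perm; rewrite ?enum_uniq // => z.
  by rewrite mem_enum inE.
apply: (sorted_eq le_trans le_anti) perm_s.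
  apply: (@sort_sorted_in _ (mem (x :: s))).
    by move=> u v su sv; apply: covers_path_chain su sv.
  by apply/allP => z; rewrite mem_enum inE.
by apply: (sub_path _ lt_s) => u v /ltW.
Qed.

Lemma covers_path_max_chain x s :
  path covers x s -> max_chain (interval x (last x s)) [set z in x :: s].
Proof.
move=> cs; apply/max_chainP; split=> [u v|z|z].
- by rewrite !(inE, in_set); apply: covers_path_chain.
- rewrite [z \in interval _ _]inE [z \in [set _ | _]]inE => sz.
  by rewrite (covers_path_ge cs sz) covers_path_le_last.
rewrite [z \in interval _ _]inE [z \in [set _ | _]]inE => /andP[le_xz le_zl] cmp.
by apply: covers_path_maximal => // u su; apply: cmp; rewrite inE.
Qed.

(** Together with [covers_path_max_chain] this replaces maximal chains of an
    interval by lists, on which the arguments about labels go by induction. *)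
Lemma max_chain_covers_path x y c :
    x <= y -> max_chain (interval x y) c ->
  exists s, [/\ path covers x s, last x s = y & c = [set z in x :: s]].
Proof.
move=> le_xy /max_chainP[chc scI maxc].
have cx: x \in c.
  apply: maxc => [|u /scI]; first by rewrite inE lexx.
  by rewrite inE => /andP[/le_comparable].
have cy: y \in c.
  apply: maxc => [|u /scI]; first by rewrite inE lexx le_xy.
  by rewrite inE comparable_sym => /andP[_ /le_comparable].
have [l Dl] : {l | l = sort <=%O (enum c)} by exists (sort <=%O (enum c)).
have mem_l z: (z \in l) = (z \in c) by rewrite Dl mem_sort mem_enum.
have sorted_l: sorted <=%O l.
  rewrite Dl; apply: (@sort_sorted_in _ (mem c)) => //.
  by apply/allP => z; rewrite mem_enum.
have uniq_l: uniq l by rewrite Dl sort_uniq enum_uniq.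
have nth_le i j: (i <= j < size l)%N -> nth x l i <= nth x l j.
  case/andP => le_ij lt_j; apply: le_sorted_leq_nth => //; rewrite inE //.
  exact: leq_ltn_trans lt_j.
case: l Dl mem_l sorted_l uniq_l nth_le => [_ /(_ x)|a s Dl mem_l srt_l uniq_l nth_le].
  by rewrite cx in_nil.
have Da: a = x.
  apply: le_anti; have := mem_l a; rewrite mem_head => /esym/scI.
  rewrite inE => /andP[-> _]; rewrite andbT.
  have xl: x \in a :: s by rewrite mem_l.
  by rewrite -[leRHS](nth_index x xl); apply: (nth_le 0); rewrite index_mem.
rewrite {a}Da in Dl mem_l srt_l uniq_l nth_le *.
exists s; split; last by apply/setP => z; rewrite inE mem_l.
- apply/(pathP x) => i lt_i.
  have lt_srt: sorted <%O (x :: s) by rewrite lt_sorted_uniq_le uniq_l.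
  apply/coversP; split=> [|z le_iz le_zi]; first exact: (pathP x lt_srt).
  suff cz: z \in x :: s.
    rewrite -(nth_index x cz); case: (leqP (index z (x :: s)) i) => [le_j|lt_j].
      left; apply: le_anti; rewrite nth_le ?le_j ?ltnS ?(ltnW lt_i) //=.
      by rewrite nth_index.
    right; apply: le_anti; rewrite nth_index // le_zi /=.
    by rewrite -[leRHS](nth_index x cz); apply: (nth_le i.+1); rewrite lt_j index_mem.
  rewrite mem_l; apply: maxc => [|u].
    rewrite inE (le_trans _ le_iz) ?(le_trans le_zi) //.
      have: nth x s i \in x :: s by rewrite inE mem_nth ?orbT.
      by rewrite mem_l => /scI; rewrite inE => /andP[].
    have: nth x (x :: s) i \in x :: s by rewrite mem_nth // ltnS ltnW.
    by rewrite mem_l => /scI; rewrite inE => /andP[].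
  rewrite -mem_l => us; rewrite -(nth_index x us).
  case: (leqP (index u (x :: s)) i) => [le_j|lt_j].
    rewrite comparable_sym; apply: le_comparable; apply: le_trans le_iz.
    by apply: nth_le; rewrite le_j ltnS ltnW.
  apply: le_comparable; apply: le_trans le_zi _.
  by apply: (nth_le i.+1); rewrite lt_j index_mem.
- apply: le_anti; have: last x s \in c by rewrite -mem_l mem_last.
  move/scI; rewrite inE => /andP[_ ->] /=.
  have yl: y \in x :: s by rewrite mem_l.
  rewrite -(nth_index x yl) (last_nth x); apply: nth_le.
  by rewrite -ltnS index_mem yl /=.
Qed.

End MaximalChains.

(** * Label sequences, and the first label of an ascending chain *)

Section LabelsOfChains.

Context {d d' : Order.disp_t} {P : finPOrderType d} {Lam : porderType d'}.
Implicit Types (lam : P -> P -> Lam) (x y z : P) (c m : {set P}).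

Local Open Scope order_scope.

Lemma label_seq_covers_path lam x s :
  path covers x s -> label_seq lam [set z in x :: s] = pairmap lam x s.
Proof. by rewrite /label_seq => /sort_covers_path->. Qed.

Lemma unique_ascending_eq lam x y c c' :
  unique_ascending lam x y c -> unique_ascending lam x y c' -> c = c'.
Proof.
case/and3P=> _ _ /forallP/(_ c')/implyP uc /and3P[mc' asc' _].
by apply/eqP; rewrite eq_sym uc ?mc'.
Qed.

(** A chain of length at most one would make [z] equal to [x] or a cover of
    [x], but [y] lies strictly between them. *)
Lemma descent_chain_longer lam x y z s :
    descent lam x y z -> path covers x s -> last x s = z ->
  exists x1 x2 s2, s = [:: x1, x2 & s2].
Proof.
case/and3P=> cxy cyz _; case: s => [|x1 [|x2 s2]] /=; last by exists x1, x2, s2.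
  by move=> _ eq_xz; have := lt_trans (covers_lt cxy) (covers_lt cyz); rewrite eq_xz ltxx.
rewrite andbT => cxz eq_z; move: cxz; rewrite {x1}eq_z => cxz.
case: (covers_squeeze cxz (covers_le cxy) (covers_le cyz)) (covers_lt cxy) (covers_lt cyz)
  => ->; by rewrite ltxx.
Qed.

(** The lexicographic condition alone allows equal first labels; but then the
    second label of the ascending chain would be at most [lam y z], and
    [lam x y = lam x x1 <= lam x1 x2 <= lam y z] would contradict the descent. *)
Lemma ascending_first_label_lt lam x y z c :
    EL_labeling lam -> descent lam x y z -> unique_ascending lam x z c ->
  exists2 x1, covers x x1 /\ x1 \in c & lam x x1 < lam x y.
Proof.
move=> EL dxyz uc; have /and3P[cxy cyz ndesc] := dxyz.
have lt_xz: x < z by apply: lt_trans (covers_lt cxy) (covers_lt cyz).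
have [c0 /unique_ascending_eq/(_ uc)-> {c0} minc] := EL x z lt_xz.
have /and3P[maxc ascc _] := uc.
have [s [cs ls Dc]] := max_chain_covers_path (ltW lt_xz) maxc.
have [x1 [x2 [s2 Ds]]] := descent_chain_longer dxyz cs ls.
have cxyz: path covers x [:: y; z] by rewrite /= cxy cyz.
have neq_c: [set u in [:: x; y; z]] != c.
  apply: contraNneq ndesc => eq_c; move: ascc; rewrite /ascending -eq_c.
  by rewrite label_seq_covers_path //= andbT.
have := minc _ (covers_path_max_chain cxyz) neq_c.
move: ascc cs; rewrite /ascending Dc Ds => ascc cs.
move: ascc; rewrite !label_seq_covers_path //= => /andP[le12 _].
rewrite ltxi_cons; case/andP => le1.
case: (boolP (lam x y <= lam x x1)) => [ge1 /=|nge1 _].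
  rewrite ltxi_cons => /andP[le2 _].
  by rewrite (le_trans ge1 (le_trans le12 le2)) in ndesc.
exists x1; last by rewrite lt_leAnge le1.
by split; [case/andP: cs | rewrite !inE eqxx orbT].
Qed.

End LabelsOfChains.

(** * Comparing chains at the lowest place where they part *)

Section Divergence.

Context {d d' : Order.disp_t} {P : finPOrderType d} {Lam : porderType d'}.
Implicit Types (lam : P -> P -> Lam) (x y z : P) (c m : {set P}).

Local Open Scope order_scope.

(** [m] and [m'] agree up to a common element [u], where they part and [m]
    takes the smaller label.  Locating the divergence at an element rather than
    in the label sequences matters: distinct chains may carry the same labels,
    and it is the place of divergence that is compared with a polygon. *)
Definition diverges lam m m' : Prop :=
  exists u s t,
    [/\ u \in m, [set v in m | v <= u] = [set v in m' | v <= u],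
        covers u s /\ s \in m, covers u t /\ t \in m' & lam u s < lam u t].

Lemma covers_chain_inj m u s t :
  is_chain m -> s \in m -> t \in m -> covers u s -> covers u t -> s = t.
Proof.
move=> /is_chainP chm ms mt cs ct; apply: le_anti.
rewrite (covers_comparable_le cs (covers_lt ct)) ?chm //.
by rewrite (covers_comparable_le ct (covers_lt cs)) ?chm.
Qed.

Lemma below_eq_mem m m' u v :
    [set v in m | v <= u] = [set v in m' | v <= u] -> v <= u ->
  (v \in m) = (v \in m').
Proof. by move=> /setP/(_ v); rewrite !inE => + le_vu; rewrite le_vu !andbT. Qed.

Lemma diverges_irr lam m : is_chain m -> ~ diverges lam m m.
Proof.
move=> chm [u] [s] [t] [_ _ [cs ms] [ct mt]].
by rewrite (covers_chain_inj chm ms mt cs ct) ltxx.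
Qed.

(** The two places of divergence both lie on [m'], so they are comparable, and
    the lower one is where [m] and [m''] part. *)
Lemma diverges_trans lam m m' m'' :
  is_chain m' -> diverges lam m m' -> diverges lam m' m'' -> diverges lam m m''.
Proof.
move=> chm' [u] [s] [t] [mu eq_u [cs ms] [ct m't] lt_st].
move=> [u'] [s'] [t'] [m'u' eq_u' [cs' m's'] [ct' m''t'] lt_st'].
have m'u: u \in m' by rewrite -(below_eq_mem eq_u).
have below_trans v : v <= u -> v <= u' ->
    [set w in m | w <= v] = [set w in m'' | w <= v].
  move=> le_vu le_vu'; apply/setP => w; rewrite !inE.
  case le_wv: (w <= v); rewrite ?andbF // !andbT.
  by rewrite (below_eq_mem eq_u) ?(below_eq_mem eq_u') // (le_trans le_wv).
have cmp v w : v \in m' -> w \in m' -> v >=< w by apply/is_chainP.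
case: (comparable_ltgtP (cmp u u' m'u m'u')) => [lt_uu'|lt_u'u|eq_uu'].
- exists u, s, t; split=> //; first by apply: below_trans => //; apply: ltW.
  split=> //; rewrite -(below_eq_mem eq_u') //.
  exact: covers_comparable_le ct lt_uu' (cmp _ _ m't m'u').
- exists u', s', t'; split=> //.
  + by rewrite (below_eq_mem eq_u) // ltW.
  + by apply: below_trans => //; apply: ltW.
  split=> //; rewrite (below_eq_mem eq_u) //.
  exact: covers_comparable_le cs' lt_u'u (cmp _ _ m's' m'u).
- subst u'; exists u, s, t'; split=> //; first exact: below_trans.
  by apply: lt_trans lt_st _; rewrite (covers_chain_inj chm' m't m's' ct cs').
Qed.

End Divergence.

(** * Polygon strong labelings are polygon complete *)

Section PolygonMoves.

Context {d d' : Order.disp_t} {P : finPOrderType d} {Lam : porderType d'}.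
Implicit Types (lam : P -> P -> Lam) (x y z : P) (c m : {set P}).

Local Open Scope order_scope.

Lemma covers_dual x y : @covers _ P^d x y = covers y x.
Proof.
rewrite /covers; congr (_ && _); apply: eq_forallb => z.
by rewrite andbC.
Qed.

Lemma is_chain_dual m : @is_chain _ P^d m = is_chain m.
Proof.
apply: eq_forallb => x; congr (_ ==> _); apply: eq_forallb => y.
by congr (_ ==> _); rewrite /Order.comparable orbC.
Qed.

Lemma max_chain_is_chain (A m : {set P}) : max_chain A m -> is_chain m.
Proof. by case/max_chainP => chm _ _; apply/is_chainP. Qed.

Lemma above_eq_mem m m' u v :
    [set v in m | u <= v] = [set v in m' | u <= v] -> u <= v ->
  (v \in m) = (v \in m').
Proof. by move=> /setP/(_ v); rewrite !inE => + le_uv; rewrite le_uv !andbT. Qed.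

(** The same comparison read from the top, where [m'] takes the smaller label:
    it is [diverges] for the dual poset, with the two chains exchanged. *)
Definition codiverges lam m m' : Prop :=
  @diverges _ _ P^d _ (fun x y => lam y x) m' m.

Lemma codivergesI lam m m' v s t :
    v \in m -> v \in m' -> [set u in m | v <= u] = [set u in m' | v <= u] ->
    covers s v -> s \in m -> covers t v -> t \in m' -> lam t v < lam s v ->
  codiverges lam m m'.
Proof.
by move=> mv m'v eq_v *; exists v, t, s; split; rewrite ?covers_dual.
Qed.

(** The data hidden by the existential quantifiers of a polygon move, with the
    polygon exposed. *)
Record move_at lam m m' x y z : Prop := MoveAt {
  move_descent : descent lam x y z;
  move_mem : [/\ x \in m', y \in m' & z \in m'];
  move_below : [set u in m | u <= x] = [set u in m' | u <= x];
  move_above : [set u in m | z <= u] = [set u in m' | z <= u];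
  move_ascending : unique_ascending lam x z (m :&: interval x z) }.

Lemma polygon_moveP lam m m' :
    polygon_move lam m m' ->
  [/\ max_chain setT m, max_chain setT m' & exists x y z, move_at lam m m' x y z].
Proof.
case/and3P=> maxm maxm' /existsP[x] /existsP[y] /existsP[z].
case/and5P => lt_xz /andP[/setIP[mx m'x] /setIP[mz m'z]] /eqP eqx /eqP eqz.
case/and3P => /andP[/eqP eqI dxyz] my uc; split=> //; exists x, y, z; split=> //.
split=> //; have: y \in m' :&: interval x z by rewrite eqI !inE eqxx orbT.
by case/setIP.
Qed.

Lemma move_diverges lam m m' x y z :
  EL_labeling lam -> move_at lam m m' x y z -> diverges lam m m'.
Proof.
move=> EL [dxyz [m'x m'y _] eqx _ uc].
have [x1 [cx1 /setIP[mx1 _]] lt_x1] := ascending_first_label_lt EL dxyz uc.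
exists x, x1, y; split=> //; last by split=> //; case/and3P: dxyz.
by rewrite (below_eq_mem eqx).
Qed.

(** A move lowers the label of the last step of the polygon: polygon strength,
    applied to the coatom [y'] of the ascending chain lying on [m]. *)
Lemma move_coatom lam m m' x y z :
    polygon_strong lam -> move_at lam m m' x y z ->
  exists y', [/\ covers y' z, y' \in m & lam y z < lam y' z].
Proof.
move=> [_ PS] [dxyz _ _ _ uc].
have /and3P[cxy cyz _] := dxyz.
have le_xz: x <= z by apply: le_trans (covers_le cxy) (covers_le cyz).
have /and3P[maxc _ _] := uc.
have [s [cs ls Dc]] := max_chain_covers_path le_xz maxc.
have [y' y'c cy'z]: exists2 y', y' \in m :&: interval x z & covers y' z.
  rewrite Dc; case/lastP: s cs ls {Dc} => [|s z'].
    by move=> _ /= eq_xz; have := lt_le_trans (covers_lt cxy) (covers_le cyz);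
      rewrite eq_xz ltxx.
  rewrite last_rcons rcons_path => /andP[_ cl] eq_z'; rewrite eq_z' in cl *.
  by exists (last x s) => //; rewrite inE -rcons_cons mem_rcons in_cons mem_last orbT.
by exists y'; split=> //; [case/setIP: y'c | apply: PS dxyz _ _ uc _ _].
Qed.

Lemma move_codiverges lam m m' x y z :
  polygon_strong lam -> move_at lam m m' x y z -> codiverges lam m m'.
Proof.
move=> PS mv; have [y' [cy'z my' lt_y']] := move_coatom PS mv.
have [/and3P[_ cyz _] [_ m'y m'z] _ eqz _] := mv.
have mz: z \in m by rewrite (above_eq_mem eqz).
exact: codivergesI mz m'z eqz cy'z my' cyz m'y lt_y'.
Qed.

(** A sequence of moves inherits from single moves any comparison that is
    transitive through chains. *)
Lemma chain_descent_le_sub (R : {set P} -> {set P} -> Prop) lam :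
    (forall m m', polygon_move lam m m' -> R m m') ->
    (forall m m' m'', is_chain m' -> R m m' -> R m' m'' -> R m m'') ->
  forall m m', chain_descent_le lam m m' -> m = m' \/ R m m'.
Proof.
move=> moveR transR m m' /connectP[p pm ->].
elim: p m pm => [|m1 p IHp] m /=; first by left.
case/andP => mm1 /IHp IHm1; right; have Rm := moveR _ _ mm1.
case: IHm1 => [<-//|]; apply: transR Rm.
by have [_ /max_chain_is_chain] := polygon_moveP mm1.
Qed.

Lemma polygon_strong_diverges lam m m' :
  polygon_strong lam -> chain_descent_le lam m m' -> m = m' \/ diverges lam m m'.
Proof.
case=> EL _; apply: chain_descent_le_sub => {m m'} [m m'|m m' m'']; last first.
  exact: diverges_trans.
by case/polygon_moveP => _ _ [x] [y] [z]; apply: move_diverges.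
Qed.

Lemma codiverges_trans lam m m' m'' :
    is_chain m' -> codiverges lam m m' -> codiverges lam m' m'' ->
  codiverges lam m m''.
Proof.
by move=> chm' Dm Dm'; apply: diverges_trans Dm' Dm; rewrite is_chain_dual.
Qed.

Lemma codiverges_irr lam m : is_chain m -> ~ codiverges lam m m.
Proof. by move=> chm; apply: diverges_irr; rewrite is_chain_dual. Qed.

Lemma polygon_strong_codiverges lam m m' :
    polygon_strong lam -> chain_descent_le lam m m' ->
  m = m' \/ codiverges lam m m'.
Proof.
move=> PS; apply: chain_descent_le_sub => {m m'} [m m'|m m' m'']; last first.
  exact: codiverges_trans.
by case/polygon_moveP => _ _ [x] [y] [z]; apply: move_codiverges.
Qed.

(** The polygon determines the source of a move: outside of [[x, z]] the source
    agrees with the target, and inside it is the unique ascending chain. *)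
Lemma move_source_eq lam m1 m2 m' x y z :
    is_chain m1 -> is_chain m2 ->
  move_at lam m1 m' x y z -> move_at lam m2 m' x y z -> m1 = m2.
Proof.
move=> ch1 ch2 [_ [m'x _ m'z] bel1 abv1 uc1] [_ _ bel2 abv2 uc2].
have eqI := unique_ascending_eq uc1 uc2; rewrite -bel2 in bel1; rewrite -abv2 in abv1.
have x2 : x \in m2 by rewrite (below_eq_mem bel2).
have z2 : z \in m2 by rewrite (above_eq_mem abv2).
have x1 : x \in m1 by rewrite (below_eq_mem bel1).
have z1 : z \in m1 by rewrite (above_eq_mem abv1).
apply/setP => w; have /setP/(_ w) := bel1; have /setP/(_ w) := abv1.
have /setP/(_ w) := eqI; rewrite !inE.
case: (boolP (w <= x)) => [_|nwx]; first by rewrite !andbT.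
case: (boolP (z <= w)) => [_|nzw]; first by rewrite !andbT.
move=> eqw _ _; move: eqw.
have tot m : is_chain m -> x \in m -> z \in m -> w \in m -> (x <= w <= z).
  move=> /is_chainP chm mx mz mw.
  have /orP[->|/(negP nwx)//] := chm x w mx mw.
  by have /orP[->|/(negP nzw)//] := chm w z mw mz.
case w1: (w \in m1); case w2: (w \in m2) => //=.
  by rewrite (tot m1).
by rewrite (tot m2) // => /esym.
Qed.

(** The last move of a sequence from [m] to [m'] must take place at the same
    polygon as the given move: at a lower place it would start from a chain
    that precedes [m] for [diverges], at a higher place from one that precedes
    [m] for [codiverges]. *)
Theorem polygon_strong_complete lam : polygon_strong lam -> polygon_complete lam.
Proof.
move=> PS m m' mv; have EL := PS.1.
have [/max_chain_is_chain chm /max_chain_is_chain chm' [x [y [z mxyz]]]] :=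
  polygon_moveP mv.
split.
  apply/andP; split; last exact: connect1.
  apply/eqP => eqm; rewrite -eqm in mxyz.
  exact: diverges_irr chm (move_diverges EL mxyz).
move=> m'' /max_chain_is_chain chm'' [/andP[neq_m le_m] /andP[neq_m'' le_m'']].
have [k le_k mvk]: exists2 k, chain_descent_le lam m'' k & polygon_move lam k m'.
  move: le_m'' neq_m''; case/connectP => p; case/lastP: p => [|p k'] /=.
    by move=> _ ->; rewrite eqxx.
  rewrite last_rcons rcons_path => /andP[pm mvk] -> _.
  by exists (last m'' p) => //; apply/connectP; exists p.
have le_mk: chain_descent_le lam m k := connect_trans le_m le_k.
have [/max_chain_is_chain chk _ [u [t [v muv]]]] := polygon_moveP mvk.
suff eq_k: k = m.
  have [|Dm] := polygon_strong_diverges PS le_m; first by move/eqP: neq_m.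
  rewrite eq_k in le_k; have [/esym|Dm''] := polygon_strong_diverges PS le_k.
    by move/eqP: neq_m.
  exact: diverges_irr chm (diverges_trans chm'' Dm Dm'').
have [/and3P[cxy cyz _] [m'x m'y m'z] eqx eqz _] := mxyz.
have [duv [m'u m't m'v] equ eqv uc] := muv; have /and3P[cut ctv _] := duv.
have cmp a b : a \in m' -> b \in m' -> a >=< b by apply/is_chainP.
case: (comparable_ltgtP (cmp u x m'u m'x)) => [lt_ux|lt_xu|eq_ux].
(* Below [x] the chains [m] and [m'] agree, so [m] contains the new step
     [u <. t], while [k] has the smaller label there. *)
- have le_tx := covers_comparable_le cut lt_ux (cmp _ _ m't m'x).
  suff Dk: diverges lam k m.
    case: (polygon_strong_diverges PS le_mk) => [//|Dmk].
    by case: (diverges_irr chm (diverges_trans chk Dmk Dk)).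
  have [s [cus /setIP[ks _]] lt_s] := ascending_first_label_lt EL duv uc.
  exists u, s, t; split=> //.
  + by rewrite (below_eq_mem equ).
  + rewrite equ; apply/setP => a; rewrite !inE; case le_au: (a <= u); rewrite ?andbF //.
    by rewrite (below_eq_mem eqx) // (le_trans le_au) // ltW.
  + by rewrite (below_eq_mem eqx).
(* Dually [t >= z], so [m] contains the new step [t <. v], while [k] has the
     larger label there. *)
- have le_yu : y <= u.
    by apply: covers_comparable_le cxy lt_xu (cmp _ _ m'y m'u).
  have le_zt : z <= t.
    have lt_yt := le_lt_trans le_yu (covers_lt cut).
    exact: covers_comparable_le cyz lt_yt (cmp _ _ m'z m't).
  suff Dk: codiverges lam k m.
    case: (polygon_strong_codiverges PS le_mk) => [//|Dmk].
    by case: (codiverges_irr chm (codiverges_trans chk Dmk Dk)).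
  have [v' [cv'v kv' lt_v']] := move_coatom PS muv.
  have le_zv := le_trans le_zt (covers_le ctv).
  apply: codivergesI cv'v kv' ctv _ lt_v'.
  + by rewrite (above_eq_mem eqv).
  + by rewrite (above_eq_mem eqz).
  + rewrite eqv; apply/setP => a; rewrite !inE; case le_va: (v <= a); rewrite ?andbF //.
    by rewrite (above_eq_mem eqz) // (le_trans le_zv).
  + by rewrite (above_eq_mem eqz).
have eq_t: t = y.
  by apply: covers_chain_inj chm' m't m'y cut _; rewrite eq_ux.
have eq_v: v = z.
  by apply: covers_chain_inj chm' m'v m'z ctv _; rewrite eq_t.
subst u t v; exact: move_source_eq muv mxyz.
Qed.

End PolygonMoves.

(** * The labeling of a supersolvable lattice by an M-chain *)

Section MChainLabeling.

Context {d : Order.disp_t} {L : finTBLatticeType d}.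
Variables (n : nat) (w : 'I_n.+1 -> L).
Hypothesis Mw : M_chain w.
Implicit Types (x y z : L) (c m : {set L}) (s : seq L) (i : 'I_n.+1).

Local Open Scope order_scope.
Local Notation lam := (M_chain_labeling w).

(** Distributivity in the sublattice generated by the chain [{x, y}] and the
    M-chain. *)
Lemma M_chain_modular x y i :
  x <= y -> (x `|` w i) `&` y = x `|` (w i `&` y).
Proof.
move=> le_xy; have [_ _ _ distM] := Mw.
have chain_xy: is_chain [set x; y].
  apply/is_chainP => a b; rewrite !inE.
  case/orP=> /eqP->; case/orP=> /eqP->; rewrite ?comparablexx //.
    exact: le_comparable.
  by rewrite comparable_sym le_comparable.
have dist := distM _ chain_xy.
have gen a : a \in [set x; y] :|: [set w i | i : 'I_n.+1] ->
    a \in generated_sublattice ([set x; y] :|: [set w i | i : 'I_n.+1]).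
  by move=> Aa; apply/bigcapP => S /andP[_ /subsetP]; apply.
have gx := gen x; have gy := gen y; have gw := gen (w i).
rewrite meetC (dist y x (w i)) ?gx ?gy ?gw ?inE ?eqxx ?orbT //.
  by rewrite (meet_r le_xy) (meetC y).
by apply/orP; right; apply/imsetP; exists i.
Qed.

Lemma M_chain_mono (i j : 'I_n.+1) : (i <= j)%N -> w i <= w j.
Proof.
have [_ _ cov _] := Mw.
case: j => j; elim: j => [|j IHj] lt_j le_ij.
  by rewrite (_ : i = Ordinal lt_j) //; apply/val_inj/eqP; rewrite -leqn0.
move: le_ij; rewrite leq_eqVlt => /predU1P[eq_ij|lt_ij].
  by rewrite (_ : i = Ordinal lt_j) //; apply: val_inj.
have lt_jn : (j < n)%N by [].
apply: le_trans (IHj (ltnW lt_j) _) _ => //.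
have := covers_le (cov (Ordinal lt_jn)).
by rewrite (_ : widen_ord _ _ = Ordinal (ltnW lt_j)) 1?(_ : lift _ _ = Ordinal lt_j) //;
  apply: val_inj.
Qed.

Lemma M_label_le x y i : x <= y -> (lam x y <= i)%N = (y <= x `|` w i).
Proof.
move=> le_xy; rewrite /M_chain_labeling.
have [_ w1 _ _] := Mw.
case: arg_minnP => [|j /eqP eq_j min_j]; first by rewrite w1 !joinx1.
apply/idP/idP => [le_ji|le_y].
  apply: le_trans (leU2 (lexx x) (M_chain_mono le_ji)).
  by rewrite eq_j leUl.
by apply: min_j; rewrite eq_le leU2 //= leUx le_y leUr.
Qed.

(** The element [x1] is [(x \/ w_i) /\ y] for the least [i] that makes this
    different from [x].  It covers [x] because [w_i] covers its predecessor [v]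
    in the M-chain: for [z] between [x] and [x1], the element [(v \/ z) /\ w_i]
    is [v] or [w_i], and by modularity [z] is [x] or [x1] accordingly. *)
Lemma M_chain_atom x y :
    x < y ->
  exists i x1, [/\ covers x x1, x1 <= x `|` w i, w i `&` y <= x1, x1 <= y &
    forall z, covers x z -> z <= y -> z != x1 -> (i < lam x z)%N].
Proof.
move=> lt_xy; have [w0 w1 cov _] := Mw.
pose Q i := ~~ ((x `|` w i) `&` y <= x).
have Qmax: Q ord_max by rewrite /Q w1 joinx1 meet1x lt_geF.
case: (arg_minnP (fun i => i : nat) Qmax) => i Qi min_i.
have [j Di]: exists j, i = lift ord0 j.
  case: (unliftP ord0 i) => [j ->|i0]; first by exists j.
  by move: Qi; rewrite i0 /Q w0 joinx0 leIl.
set v := w (widen_ord (leqnSn n) j).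
(* The predecessor [v] of [w i] in the M-chain fails [Q] by minimality. *)
have Nv: (x `|` v) `&` y <= x.
  apply/negPn/negP => /min_i; rewrite Di /= /bump /=.
  by rewrite ltnn.
have cvw: covers v (w i) by rewrite Di; apply: cov.
pose x1 := (x `|` w i) `&` y.
have le_x1: x <= x1 by rewrite lexI leUl ltW.
have c1: covers x x1.
  apply/coversP; split=> [|z le_xz le_z].
    by rewrite lt_leAnge le_x1.
  have le_vw := covers_le cvw.
  have le_vt: v <= (v `|` z) `&` w i by rewrite lexI leUl.
  case: (covers_squeeze cvw le_vt (leIr _ _)) => eq_t; [left|right].
    apply: le_anti; rewrite le_xz andbT.
    have le_zw: z <= x `|` w i by apply: le_trans le_z (leIl _ _).
    rewrite -[z](meet_r le_zw) M_chain_modular // leUx lexx /=.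
    apply: le_trans Nv; rewrite lexI; apply/andP; split; last first.
      exact: le_trans (leIr _ _) (le_trans le_z (leIr _ _)).
    apply: le_trans (leUr _ _); rewrite -[leRHS]eq_t lexI leIl andbT.
    exact: le_trans (leIr _ _) (leUr _ _).
  apply: le_anti; rewrite le_z /=.
  have le_wvz: w i <= v `|` z by rewrite -eq_t leIl.
  have le_x1v: x1 <= z `|` v.
    apply: le_trans (leIl _ _) _; rewrite leUx (le_trans le_xz) ?leUl //=.
    by rewrite joinC.
  rewrite -[x1](meet_r le_x1v) M_chain_modular // leUx lexx /=.
  apply: le_trans le_xz; apply: le_trans Nv.
  by rewrite lexI (le_trans (leIl _ _)) ?leUr //= (le_trans (leIr _ _)) ?leIr.
exists i, x1; split; rewrite ?leIl ?leIr //.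
- by rewrite /x1 (M_chain_modular i (ltW lt_xy)) leUr.
- move=> z cxz le_zy neq_z; rewrite ltnNge; apply/negP.
  rewrite M_label_le ?(covers_le cxz) // => le_z.
  have le_zx1: z <= x1 by rewrite lexI le_z.
  case: (covers_squeeze c1 (covers_le cxz) le_zx1) => [eq_z|]; last by move/eqP: neq_z.
  by have := covers_lt cxz; rewrite eq_z ltxx.
Qed.

(** By modularity [(z \/ w_i) /\ u = z \/ (w_i /\ u) = z], so [u] is not below
    [z \/ w_i]. *)
Lemma M_label_gt y i z u :
  w i `&` y <= z -> z < u -> u <= y -> (i < lam z u)%N.
Proof.
move=> le_wz lt_zu le_uy; rewrite ltnNge (M_label_le i (ltW lt_zu)).
apply/negP => le_u; suff eq_uz: u = z by move: lt_zu; rewrite eq_uz ltxx.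
apply: le_anti; rewrite (ltW lt_zu) andbT -[u](meet_r le_u).
rewrite (M_chain_modular i (ltW lt_zu)) leUx lexx (le_trans _ le_wz) //.
by rewrite leI2.
Qed.

(** The cover swallows [y], so [u = z \/ y], which is below [z \/ w_i]. *)
Lemma M_label_join_le y z u i :
    covers z u -> y <= u -> ~~ (y <= z) -> y <= z `|` w i -> (lam z u <= i)%N.
Proof.
move=> czu le_yu nle_yz le_y; rewrite M_label_le ?(covers_le czu) //.
have le_zy: z `|` y <= u by rewrite leUx (covers_le czu).
case: (covers_squeeze czu (leUl z y) le_zy) => [eq_z|<-].
  by case/negP: nle_yz; rewrite -eq_z leUr.
by rewrite leUx leUl.
Qed.

(** Look at the step at which the chain first gets above [y]. *)
Lemma M_path_small_label y z s i :
    path covers z s -> y <= last z s -> ~~ (y <= z) -> y <= z `|` w i ->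
  has (fun l => l <= i)%N (pairmap lam z s).
Proof.
elim: s z => [|u s IHs] z /=; first by move=> _ ->.
case/andP => czu cs le_yl nle_yz le_y.
have [le_yu|nle_yu] := boolP (y <= u); first by rewrite (M_label_join_le czu le_yu).
by rewrite IHs ?orbT // (le_trans le_y) // leU2 ?(covers_le czu).
Qed.

(** Otherwise the first label exceeds [i], while some label is at most [i]. *)
Lemma ascending_path_atom x x1 z s i :
    covers x x1 -> x1 <= x `|` w i -> x1 <= last z s -> path covers x (z :: s) ->
    (z != x1 -> (i < lam x z)%N) ->
  sorted <=%O (pairmap lam x (z :: s)) -> z = x1.
Proof.
move=> cx1 le_x1 le_x1l cs gt_i asc; apply/eqP/negPn/negP => neq_z.
have cxz : covers x z by case/andP: cs.
have nle: ~~ (x1 <= z).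
  apply/negP => le_z; case/eqP: neq_z.
  case: (covers_squeeze cxz (covers_le cx1) le_z) => // eq_x.
  by have := covers_lt cx1; rewrite eq_x ltxx.
have nle_x: ~~ (x1 <= x) by rewrite (lt_geF (covers_lt cx1)).
have [] := hasP (M_path_small_label cs le_x1l nle_x le_x1).
move=> l /= l_in le_li; have := gt_i neq_z; rewrite ltnNge => /negP[].
move: l_in; rewrite inE => /predU1P[<- //|l_in].
by apply: leq_trans le_li; apply: (allP (order_path_min le_trans asc)).
Qed.

(** The greedy chain, which at every step takes the atom of [M_chain_atom]. *)
Lemma M_ascending_path x y :
    x <= y ->
  exists s, [/\ path covers x s, last x s = y, sorted <=%O (pairmap lam x s) &
    forall s', path covers x s' -> last x s' = y -> s' != s ->
      (pairmap lam x s < pairmap lam x s' :> seqlexi nat) /\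
      ~~ sorted <=%O (pairmap lam x s')].
Proof.
have [k] := ubnP #|[set v | x < v]|; elim: k x => // k IHk x lt_k.
rewrite le_eqVlt => /predU1P[<-|lt_xy].
  exists [::]; split=> // -[|z s] // cs eq_l.
  have := covers_path_le_last (s := z :: s) cs (mem_head _ _).
  have := covers_path_min cs (mem_last z s).
  by rewrite [last z s]eq_l ltxx.
have [i [x1 [c1 le_x1 le_wx1 le_x1y gt_i]]] := M_chain_atom lt_xy.
have [||s [cs ls asc min_s]] := IHk x1.
- rewrite ltnS in lt_k; apply: leq_trans lt_k; apply: proper_card.
  apply/properP; split; last by exists x1; rewrite inE ?ltxx ?covers_lt.
  by apply/subsetP => v; rewrite !inE; apply: lt_trans (covers_lt c1).
- by [].
have le_a: (lam x x1 <= i)%N by rewrite M_label_le ?(covers_le c1).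
exists (x1 :: s); split=> //=; first by rewrite c1.
  case: s cs ls asc {min_s} => //= x2 s /andP[c2 cs] ls ->; rewrite andbT.
  rewrite leEnat; apply: leq_trans le_a (ltnW _).
  apply: (M_label_gt le_wx1 (covers_lt c2)).
  by rewrite -ls; apply: covers_path_le_last cs (mem_head _ _).
case=> [_ eq_x|z s' cs' ls']; first by rewrite -eq_x ltxx in lt_xy.
have /andP[cxz cs'z] := cs'.
have le_zy: z <= y by rewrite -ls'; apply: covers_path_le_last cs'z (mem_head _ _).
have [eq_z neq_s|neq_z _] := eqVneq z x1.
  subst z; have neq_s': s' != s by apply: contraNneq neq_s => ->.
  have [lt_s nasc] := min_s s' cs'z ls' neq_s'.
  split; first by rewrite /= ltxi_cons lexx.
  by apply: contraNN nasc => /path_sorted.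
have lt_a: (lam x x1 < lam x z)%N by apply: leq_ltn_trans le_a (gt_i z cxz le_zy neq_z).
split; first by rewrite /= ltxi_cons !leEnat (ltnW lt_a) leqNgt lt_a.
apply/negP => asc'; case/eqP: neq_z.
apply: (ascending_path_atom c1 le_x1 _ cs' (gt_i z cxz le_zy) asc').
by rewrite [last _ _]ls'.
Qed.

Lemma M_EL_labeling : EL_labeling lam.
Proof.
move=> x y lt_xy; have [s [cs ls asc min_s]] := M_ascending_path (ltW lt_xy).
have min_c c' : max_chain (interval x y) c' -> c' != [set z in x :: s] ->
    (pairmap lam x s < label_seq lam c' :> seqlexi nat) /\ ~~ ascending lam c'.
  move=> /(max_chain_covers_path (ltW lt_xy))[s' [cs' ls' ->]] neq_c.
  rewrite /ascending label_seq_covers_path //; apply: min_s => //.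
  by apply: contraNneq neq_c => ->.
exists [set z in x :: s]; last first.
  by move=> c' mc' neq_c; rewrite label_seq_covers_path //; case: (min_c c').
apply/and3P; split.
- by rewrite -ls covers_path_max_chain.
- by rewrite /ascending label_seq_covers_path.
apply/forallP => c'; apply/implyP => /andP[mc' asc'].
by apply/negPn/negP => /(min_c c' mc')[_ /negP].
Qed.

(** The bound [i] attached to the greedy atom of [[x, z]] separates the two
    labels to be compared. *)
Lemma M_polygon_strong : polygon_strong lam.
Proof.
split=> [|x y z dxyz c y' uc y'c cy'z]; first exact: M_EL_labeling.
have /and3P[cxy cyz ndesc] := dxyz.
have lt_xz: x < z := lt_trans (covers_lt cxy) (covers_lt cyz).
have /and3P[maxc ascc _] := uc.
have [s [cs ls Dc]] := max_chain_covers_path (ltW lt_xz) maxc.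
have [x1 [x2 [s2 Ds]]] := descent_chain_longer dxyz cs ls.
have [i [v [cv le_v le_wv le_vz gt_i]]] := M_chain_atom lt_xz.
have le_x1z: x1 <= z.
  by rewrite -ls; apply: covers_path_le_last cs _; rewrite Ds !inE eqxx orbT.
(* The ascending chain starts with the greedy atom. *)
have Dx1: x1 = v.
  rewrite Ds in cs ls; have /andP[cx1 _] := cs.
  apply: (ascending_path_atom cv le_v _ cs (gt_i _ cx1 le_x1z)).
    by rewrite [last _ _]ls.
  by move: ascc; rewrite /ascending Dc Ds label_seq_covers_path.
(* The coatom [y'] is not [x], hence lies above the greedy atom. *)
have lt_y': (i < lam y' z)%N.
  apply: M_label_gt (covers_lt cy'z) (lexx z); apply: le_trans le_wv _.
  rewrite -Dx1; move: y'c; rewrite Dc Ds inE in_cons => /predU1P[Dy'|].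
    have := covers_lt cyz; rewrite Dy' in cy'z.
    by case: (covers_squeeze cy'z (covers_le cxy) (covers_le cyz)) (covers_lt cxy) => ->;
      rewrite ltxx.
  by apply: covers_path_ge; move: cs; rewrite Ds => /andP[].
(* If [y] were the greedy atom, the labels of [x <. y <. z] would ascend
   across [i]. *)
have neq_y: ~~ (v <= y).
  apply/negP => le_vy.
  case: (covers_squeeze cxy (covers_le cv) le_vy) => [eq_v|Dv].
    by have := covers_lt cv; rewrite eq_v ltxx.
  case/negP: ndesc; rewrite leEnat -Dv.
  apply: (@leq_trans i); first by rewrite M_label_le ?(covers_le cv).
  by apply/ltnW/(M_label_gt le_wv); rewrite ?Dv ?(covers_lt cyz).
rewrite ltEnat; apply: leq_ltn_trans lt_y'.
apply: (M_label_join_le cyz le_vz neq_y).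
by rewrite (le_trans le_v) // leU2 ?(covers_le cxy).
Qed.

End MChainLabeling.

Theorem theorem4p7 (d : Order.disp_t) (L : finTBLatticeType d)
    (hL : supersolvable L) (n : nat) (w : 'I_n.+1 -> L) (hw : M_chain w) :
  polygon_strong (M_chain_labeling w) /\ polygon_complete (M_chain_labeling w).
Proof.
have strong := M_polygon_strong hw.
by split=> //; apply: polygon_strong_complete.
Qed.
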